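(* Let $\ell = ax + by + cz \in \mathbb{C}[x,y,z]$ be a linear form, and for $\lambda \in \mathbb{C}\setminus\{0\}$ let $f_\lambda = xyz + \lambda \ell^3$. Then: \begin{itemize} \item if $abc \neq 0$, there is a unique $\lambda_0 \in \mathbb{C}\setminus\{0\}$ such that $\mathrm{R}(f_\lambda) = 3$ if $\lambda = \lambda_0$ and $\mathrm{R}(f_\lambda) = 4$ if $\lambda \neq \lambda_0$; \item if $abc = 0$, then $\mathrm{R}(f_\lambda) = 4$ for every $\lambda \neq 0$. \end{itemize}
   Context: For a homogeneous polynomial $f \in \mathbb{C}[x,y,z]$ of degree $d$, the Waring rank $\mathrm{R}(f)$ is the smallest $r$ such that $f = \ell_1^d + \cdots + \ell_r^d$ for some linear forms $\ell_1,\dots,\ell_r \in \mathbb{C}[x,y,z]$. *)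

(* Defs.v *)
From mathcomp Require Import all_boot all_order all_algebra.
From mathcomp Require Import reals complex.
From mathcomp Require Import mpoly.

Set Implicit Arguments.
Unset Strict Implicit.
Unset Printing Implicit Defensive.

Import GRing.Theory.
Local Open Scope ring_scope.

Section WaringRank.

Variable R : realType.

(* The linear forms may be zero, and may repeat. *)
Definition waring_decomposable (d : nat) (f : {mpoly R[i][3]}) (r : nat) : Prop :=
  exists l : 'I_r -> {mpoly R[i][3]},
    (forall k, l k \is 1.-homog) /\ f = \sum_(k < r) l k ^+ d.

(* R(f) = r, for a form f of degree d. *)
Definition is_waring_rank (d : nat) (f : {mpoly R[i][3]}) (r : nat) : Prop :=
  waring_decomposable d f r /\
  forall s : nat, waring_decomposable d f s -> (r <= s)%N.

Definition linear_form (a b c : R[i]) : {mpoly R[i][3]} :=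
  a *: 'X_0 + b *: 'X_1 + c *: 'X_2.

Definition f_lambda (a b c lambda : R[i]) : {mpoly R[i][3]} :=
  'X_0 * 'X_1 * 'X_2 + lambda *: linear_form a b c ^+ 3.

Lemma linear_form_homog (a b c : R[i]) : linear_form a b c \is 1.-homog.
Proof.
have hX (i : 'I_3) : ('X_i : {mpoly R[i][3]}) \is 1.-homog.
  by rewrite dhomogX /= mdeg1.
by rewrite /linear_form !rpredD // rpredZ.
Qed.

Lemma f_lambda_homog (a b c lambda : R[i]) : f_lambda a b c lambda \is 3.-homog.
Proof.
have hX (i : 'I_3) : ('X_i : {mpoly R[i][3]}) \is 1.-homog.
  by rewrite dhomogX /= mdeg1.
apply: rpredD.
  exact: dhomogM (dhomogM (hX _) (hX _)) (hX _).
by rewrite rpredZ // (dhomogMn 3 (linear_form_homog a b c)).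
Qed.

End WaringRank.

(* Main.v *)
(* With u0 = ax + by + cz and u1, u2, u3 obtained by changing two of its signs,
   24abc xyz = u0^3 + u1^3 + u2^3 + u3^3, so 24abc f_lambda is
   (1 + 24 abc lambda) u0^3 + u1^3 + u2^3 + u3^3; when abc = 0, a pencil of
   conics apolar to f_lambda has four base points, which give four cubes.
   Conversely, the Aronhold invariant S vanishes on sums of three cubes and is
   affine in lambda on this family: S(f_lambda) is a nonzero multiple of
   1 + 24 abc lambda. At lambda0 = -1/(24abc), rank at most 2 is excluded by a
   maximal minor of the catalecticant matrix, a multiple of
   1 + 18 abc lambda. *)
Require Import Defs.
From mathcomp Require Import all_boot all_order all_algebra.
From mathcomp Require Import reals complex.
From mathcomp Require Import mpoly.
From mathcomp Require Import ring.

Import GRing.Theory Num.Theory.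
Local Open Scope ring_scope.

(** * Cubic invariants vanishing on sums of few cubes *)

Section CubicInvariants.

Set Implicit Arguments.
Unset Strict Implicit.

Variables (V : Type) (K : comNzRingType).
Implicit Type T : V -> V -> V -> K.

(* Salmon's formula for the invariant S of a ternary cubic, written in terms of
   its polarization [T] and the vectors [x y z] of a basis. *)
Definition aronhold T (x y z : V) : K :=
  let m := T x y z in
  T x x x * T y y y * T z z z * m
  - (T y y y * T z z z * T x x y * T x x z
     + T z z z * T x x x * T y y x * T y y z
     + T x x x * T y y y * T z z x * T z z y)
  - m * (T x x x * T y y z * T z z y + T y y y * T z z x * T x x z
         + T z z z * T x x y * T y y x)
  + (T x x x * T y y x * T z z y ^+ 2 + T x x x * T z z x * T y y z ^+ 2
     + T y y y * T x x y * T z z x ^+ 2 + T y y y * T z z y * T x x z ^+ 2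
     + T z z z * T y y z * T x x y ^+ 2 + T z z z * T x x z * T y y x ^+ 2)
  - m ^+ 4
  + 2 * m ^+ 2 * (T y y x * T z z x + T z z y * T x x y + T x x z * T y y z)
  - 3 * m * (T x x y * T y y z * T z z x + T x x z * T y y x * T z z y)
  - (T y y x ^+ 2 * T z z x ^+ 2 + T z z y ^+ 2 * T x x y ^+ 2
     + T x x z ^+ 2 * T y y z ^+ 2)
  + (T z z y * T x x y * T x x z * T y y z
     + T x x z * T y y z * T y y x * T z z x
     + T y y x * T z z x * T z z y * T x x y).

(* Rows are indexed by x, y, z and columns by yz, xz, xy. *)
Definition catalecticant_minor T (x y z : V) : K :=
  T x y z * (T y x z * T z x y - T y x y * T z x z)
  - T x x z * (T y y z * T z x y - T y x y * T z y z)
  + T x x y * (T y y z * T z x z - T y x z * T z y z).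

(* Polarizations are not divided by 3!, hence the factor 6. *)
Definition cubes_polar r (l : 'I_r -> V -> K) (u v w : V) : K :=
  \sum_(k < r) 6 * (l k u * l k v * l k w).

Lemma aronhold_three_cubes (l : 'I_3 -> V -> K) x y z :
  aronhold (cubes_polar l) x y z = 0.
Proof. by rewrite /aronhold /cubes_polar !big_ord_recl !big_ord0 /=; ring. Qed.

(** Each cube contributes a matrix of rank at most 1, so two cubes give a 3 by 3 matrix of rank at
    most 2. *)
Lemma catalecticant_minor_two_cubes (l : 'I_2 -> V -> K) x y z :
  catalecticant_minor (cubes_polar l) x y z = 0.
Proof.
by rewrite /catalecticant_minor /cubes_polar !big_ord_recl !big_ord0 /=; ring.
Qed.

End CubicInvariants.

Section WaringRankFacts.

Set Implicit Arguments.
Unset Strict Implicit.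

Variable R : realType.
Local Notation C := R[i].
Implicit Types (f g X Y Z : {mpoly C[3]}) (a b c lambda : C).

(** * Operations on Waring decompositions *)

Lemma waring_decomposable_cons d f g r :
  g \is 1.-homog -> waring_decomposable d f r ->
  waring_decomposable d (g ^+ d + f) r.+1.
Proof.
move=> hg [l [hl ->]].
exists (fun k => if unlift ord0 k is Some j then l j else g); split=> [k|].
  by case: unliftP.
rewrite big_ord_recl unlift_none; congr (_ + _).
by apply: eq_bigr => k _; rewrite liftK.
Qed.

(** The scalar has a [d]-th root, which is absorbed into the linear form. *)
Lemma waring_decomposable_consZ d f g (k : C) r : (0 < d)%N ->
  g \is 1.-homog -> waring_decomposable d f r ->
  waring_decomposable d (k *: g ^+ d + f) r.+1.
Proof.
move=> d_gt0 hg; rewrite -[in k *: _](rootCK d_gt0 k) -exprZn.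
by apply: waring_decomposable_cons; rewrite rpredZ.
Qed.

Lemma waring_decomposable1 d g : g \is 1.-homog -> waring_decomposable d (g ^+ d) 1.
Proof. by move=> hg; exists (fun=> g); split=> //; rewrite big_ord1. Qed.

Lemma waring_decomposable_widen d f r s : (0 < d)%N -> (r <= s)%N ->
  waring_decomposable d f r -> waring_decomposable d f s.
Proof.
move=> d_gt0 /subnK<-; elim: (s - r)%N => // n IHn /IHn f_dec.
rewrite -[f]add0r -(scale0r (0 ^+ d)).
by apply: waring_decomposable_consZ; rewrite ?rpred0.
Qed.

(** Padding with zero forms makes decomposability monotone in the length, so excluding length [r]
    excludes all shorter ones. *)
Lemma is_waring_rankS d f r : (0 < d)%N ->
  waring_decomposable d f r.+1 -> ~ waring_decomposable d f r ->
  is_waring_rank d f r.+1.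
Proof.
move=> d_gt0 fS fr; split=> // s fs; rewrite ltnNge; apply/negP => le_sr.
exact: fr (waring_decomposable_widen d_gt0 le_sr fs).
Qed.

Lemma waring_decomposable_scale d f (k : C) r : (0 < d)%N -> k != 0 ->
  waring_decomposable d (k *: f) r -> waring_decomposable d f r.
Proof.
move=> d_gt0 k_neq0 [l [hl def_f]].
exists (fun i => d.-root k^-1 *: l i); split=> [i|]; first by rewrite rpredZ.
apply: (scalerI k_neq0); rewrite def_f scaler_sumr; apply: eq_bigr => i _.
by rewrite exprZn rootCK // scalerA mulfV // scale1r.
Qed.

(** * Evaluation and polarization *)

Lemma dhomog1E f : f \is 1.-homog ->
  f = \sum_(i < 3) f@_U_(i)%MM *: 'X_i.
Proof.
move=> hf; apply/mpolyP => m; rewrite raddf_sum /=.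
have [/mdeg1P[j /eqP->]|m_neq1] := boolP (mdeg m == 1%N).
  rewrite (bigD1 j) //= big1 => [|i i_neq_j].
    by rewrite mcoeffZ mcoeffX eqxx mulr1 addr0.
  by rewrite mcoeffZ mcoeffX eq_mnm1 (negPf i_neq_j) mulr0.
rewrite (dhomog_nemf_coeff hf m_neq1) big1 // => i _.
rewrite mcoeffZ mcoeffX; case: eqP => [m_def|_]; last by rewrite mulr0.
by rewrite -m_def mdeg1 in m_neq1.
Qed.

Definition dot3 (p v : 'I_3 -> C) : C := p 0 * v 0 + p 1 * v 1 + p 2 * v 2.

Lemma meval_dhomog1 f v : f \is 1.-homog ->
  f.@[v] = dot3 (fun i => f@_U_(i)%MM) v.
Proof.
move=> /dhomog1E {1}->; rewrite raddf_sum /= !big_ord_recl big_ord0 addr0 addrA.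
rewrite !mevalZ !mevalXU /dot3.
by congr (_ * v _ + f@_U_(_)%MM * v _ + f@_U_(_)%MM * v _); apply/val_inj.
Qed.

(** Inclusion-exclusion over the sums of [u], [v], [w] isolates the trilinear part of the cube. *)
Lemma dot3_cube_polar p u v w :
  dot3 p (u \+ v \+ w) ^+ 3 - dot3 p (u \+ v) ^+ 3 - dot3 p (u \+ w) ^+ 3
  - dot3 p (v \+ w) ^+ 3 + dot3 p u ^+ 3 + dot3 p v ^+ 3 + dot3 p w ^+ 3
  = 6 * (dot3 p u * dot3 p v * dot3 p w).
Proof.
have dot3D t t' : dot3 p (t \+ t') = dot3 p t + dot3 p t'.
  by rewrite /dot3 /=; ring.
by rewrite !dot3D; ring.
Qed.

(** Normalized so that the diagonal value at [u] is 6 times the value of the cubic; the first six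
    terms polarize xyz. *)
Definition f_lambda_polar a b c lambda (u v w : 'I_3 -> C) : C :=
  let l v := a * v 0 + b * v 1 + c * v 2 in
  u 0 * v 1 * w 2 + u 0 * v 2 * w 1 + u 1 * v 0 * w 2
  + u 1 * v 2 * w 0 + u 2 * v 0 * w 1 + u 2 * v 1 * w 0
  + 6 * lambda * (l u * l v * l w).

Lemma waring_decomposable_polar a b c lambda r :
  waring_decomposable 3 (f_lambda a b c lambda) r ->
  exists l : 'I_r -> ('I_3 -> C) -> C, forall u v w,
    f_lambda_polar a b c lambda u v w = cubes_polar l u v w.
Proof.
case=> l [hl def_f]; exists (fun k => dot3 (fun i => (l k)@_U_(i)%MM)) => u v w.
pose p k i := (l k)@_U_(i)%MM.
have eval_f t : t 0 * t 1 * t 2 + lambda * (a * t 0 + b * t 1 + c * t 2) ^+ 3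
    = \sum_(k < r) dot3 (p k) t ^+ 3.
  have := congr1 (meval t) def_f; rewrite /f_lambda /linear_form.
  rewrite !(mevalD, mevalM, mevalZ, mevalXU, rmorphXn) /= => ->.
  rewrite raddf_sum /=; apply: eq_bigr => k _.
  by rewrite rmorphXn /= meval_dhomog1.
(* [P] is the third finite difference at the origin, without the value at 0, which is zero for a
   cubic form. *)
pose P (F : ('I_3 -> C) -> C) := F (u \+ v \+ w) - F (u \+ v) - F (u \+ w)
  - F (v \+ w) + F u + F v + F w.
transitivity (P (fun t => \sum_(k < r) dot3 (p k) t ^+ 3)).
  rewrite /P -!eval_f /f_lambda_polar /=; ring.
rewrite /P -!sumrN -!big_split /=; apply: eq_bigr => k _.
exact: dot3_cube_polar.
Qed.

(** * Obstructions to three and to two cubes *)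

Definition basis3 (i j : 'I_3) : C := (j == i)%:R.

Lemma aronhold_f_lambda a b c lambda :
  aronhold (f_lambda_polar a b c lambda) (basis3 0) (basis3 1) (basis3 2)
  = - (1 + 24 * lambda * (a * b * c)).
Proof. rewrite /aronhold /f_lambda_polar /basis3 /=; ring. Qed.

Lemma catalecticant_minor_f_lambda a b c lambda :
  catalecticant_minor (f_lambda_polar a b c lambda)
    (basis3 0) (basis3 1) (basis3 2) = 1 + 18 * lambda * (a * b * c).
Proof. rewrite /catalecticant_minor /f_lambda_polar /basis3 /=; ring. Qed.

Lemma f_lambda_three_cubes a b c lambda :
  waring_decomposable 3 (f_lambda a b c lambda) 3 ->
  1 + 24 * lambda * (a * b * c) = 0.
Proof.
move=> /waring_decomposable_polar[l eq_l].
apply/eqP; rewrite -oppr_eq0 -aronhold_f_lambda.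
by rewrite -(aronhold_three_cubes l (basis3 0) (basis3 1) (basis3 2))
  /aronhold !eq_l.
Qed.

Lemma f_lambda_two_cubes a b c lambda :
  waring_decomposable 3 (f_lambda a b c lambda) 2 ->
  1 + 18 * lambda * (a * b * c) = 0.
Proof.
move=> /waring_decomposable_polar[l eq_l]; rewrite -catalecticant_minor_f_lambda.
by rewrite -(catalecticant_minor_two_cubes l
  (basis3 0) (basis3 1) (basis3 2)) /catalecticant_minor !eq_l.
Qed.

(** * Explicit decompositions *)

Lemma scaled_four_cubes a b c lambda X Y Z :
  (24 * (a * b * c)) *: (X * Y * Z + lambda *: (a *: X + b *: Y + c *: Z) ^+ 3)
  = (1 + 24 * lambda * (a * b * c)) *: (a *: X + b *: Y + c *: Z) ^+ 3
    + ((a *: X - b *: Y - c *: Z) ^+ 3 + ((b *: Y - a *: X - c *: Z) ^+ 3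
    + (c *: Z - a *: X - b *: Y) ^+ 3)).
Proof. rewrite -!mul_mpolyC; ring. Qed.

Lemma natC_neq0 n : n.+1%:R != 0 :> C.
Proof. by rewrite pnatr_eq0. Qed.

Lemma waring4_triangle_cube a b c lambda X Y Z :
  X \is 1.-homog -> Y \is 1.-homog -> Z \is 1.-homog -> a * b * c != 0 ->
  waring_decomposable 3 (X * Y * Z + lambda *: (a *: X + b *: Y + c *: Z) ^+ 3) 4.
Proof.
move=> hX hY hZ abc_neq0.
apply: (@waring_decomposable_scale _ _ (24 * (a * b * c))) => //.
  by rewrite mulf_neq0 ?natC_neq0.
rewrite scaled_four_cubes; apply: waring_decomposable_consZ => //.
  by rewrite !(rpredD, rpredZ).
do 2?[apply: waring_decomposable_cons]; try apply: waring_decomposable1;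
  by rewrite !(rpredD, rpredN, rpredZ, hX, hY, hZ).
Qed.

Lemma waring3_triangle_cube a b c lambda X Y Z :
  X \is 1.-homog -> Y \is 1.-homog -> Z \is 1.-homog -> a * b * c != 0 ->
  1 + 24 * lambda * (a * b * c) = 0 ->
  waring_decomposable 3 (X * Y * Z + lambda *: (a *: X + b *: Y + c *: Z) ^+ 3) 3.
Proof.
move=> hX hY hZ abc_neq0 lambda_eq.
apply: (@waring_decomposable_scale _ _ (24 * (a * b * c))) => //.
  by rewrite mulf_neq0 ?natC_neq0.
(* At this parameter the first of the four cubes has coefficient 0. *)
rewrite scaled_four_cubes lambda_eq scale0r add0r.
do 2?[apply: waring_decomposable_cons]; try apply: waring_decomposable1;
  by rewrite !(rpredD, rpredN, rpredZ, hX, hY, hZ).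
Qed.

Lemma waring4_triangle X Y Z :
  X \is 1.-homog -> Y \is 1.-homog -> Z \is 1.-homog ->
  waring_decomposable 3 (X * Y * Z) 4.
Proof.
move=> hX hY hZ; rewrite -[X * Y * Z]addr0 -(scale0r ((1 *: X + 1 *: Y + 1 *: Z) ^+ 3)).
by apply: waring4_triangle_cube; rewrite // !mulr1 oner_neq0.
Qed.

(* The linear forms are the base points (s : 1 : 1), (-s : 1 : 1),
   (is : 1 : -1), (-is : 1 : -1) of the apolar conics Y^2 = Z^2, X^2 = 6aYZ,
   rescaled to absorb their weights. *)
Lemma scaled_side_cubes a s X Y Z : s ^+ 2 = 6 * a ->
  (24 * s) *: (X * Y * Z + a *: X ^+ 3)
  = (s *: X + (Y + Z)) ^+ 3 + ((s *: X - (Y + Z)) ^+ 3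
    + ((s *: X + 'i *: (Y - Z)) ^+ 3 + (s *: X - 'i *: (Y - Z)) ^+ 3)).
Proof.
move=> s_sqr; have I_sqr : ('i%:MP ^+ 2 : {mpoly C[3]}) = -1.
  by rewrite -rmorphXn /= sqrCi rmorphN1.
have S_sqr : (s%:MP ^+ 2 : {mpoly C[3]}) = 6 * a%:MP.
  by rewrite -rmorphXn /= s_sqr rmorphM /= rmorph_nat.
by rewrite -!mul_mpolyC; ring: I_sqr S_sqr.
Qed.

Lemma waring4_side_cube a X Y Z :
  X \is 1.-homog -> Y \is 1.-homog -> Z \is 1.-homog -> a != 0 ->
  waring_decomposable 3 (X * Y * Z + a *: X ^+ 3) 4.
Proof.
move=> hX hY hZ a_neq0; pose s := sqrtC (6 * a).
apply: (@waring_decomposable_scale _ _ (24 * s)) => //.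
  by rewrite mulf_neq0 ?natC_neq0 // sqrtC_eq0 mulf_neq0 ?natC_neq0.
rewrite (scaled_side_cubes _ _ _ (sqrtCK _)).
do 3?[apply: waring_decomposable_cons]; try apply: waring_decomposable1;
  by rewrite !(rpredD, rpredN, rpredZ, hX, hY, hZ).
Qed.

Lemma cube_root_unityP : exists w : C, w ^+ 2 = - w - 1.
Proof.
(* The constant -1 lists the coefficients of w^2 = -1 - w, the equation of the primitive cube roots
   of unity. *)
have [w w_sqr] := @solve_monicpoly C 2%N (fun=> -1) isT.
by exists w; rewrite w_sqr !big_ord_recl big_ord0 /=; ring.
Qed.

(* Replacing Z by W turns the cubic into a nodal one,
   XYW + lambda a^3 X^3 + lambda b^3 Y^3, with the node (0 : 0 : 1) and three
   points permuted by the cube roots of unity as apolar points. *)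
Lemma scaled_vertex_cubes a b lambda w X Y Z (rho := lambda * a * b)
    (W := Z + (3 * rho) *: (a *: X + b *: Y)) :
  w ^+ 2 = - w - 1 ->
  (648 * rho ^+ 2 * a * b) *: (X * Y * Z + lambda *: (a *: X + b *: Y) ^+ 3)
  = (-3) *: W ^+ 3 + (((6 * rho) *: (a *: X + b *: Y) + W) ^+ 3
    + (((6 * rho) *: ((a * w) *: X + (b * w ^+ 2) *: Y) + W) ^+ 3
    + ((6 * rho) *: ((a * w ^+ 2) *: X + (b * w) *: Y) + W) ^+ 3)).
Proof.
move=> w_sqr; have W_sqr : (w%:MP ^+ 2 : {mpoly C[3]}) = - w%:MP - 1.
  by rewrite -rmorphXn /= w_sqr rmorphB rmorphN rmorph1.
by rewrite /W /rho -!mul_mpolyC; ring: W_sqr.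
Qed.

Lemma waring4_vertex_cube a b lambda X Y Z :
  X \is 1.-homog -> Y \is 1.-homog -> Z \is 1.-homog ->
  a != 0 -> b != 0 -> lambda != 0 ->
  waring_decomposable 3 (X * Y * Z + lambda *: (a *: X + b *: Y) ^+ 3) 4.
Proof.
move=> hX hY hZ a_neq0 b_neq0 lambda_neq0; have [w w_sqr] := cube_root_unityP.
pose rho := lambda * a * b.
apply: (@waring_decomposable_scale _ _ (648 * rho ^+ 2 * a * b)) => //.
  by rewrite !(mulf_neq0, expf_neq0) ?natC_neq0.
rewrite (scaled_vertex_cubes _ _ _ _ _ _ w_sqr).
set W := Z + _; have hW : W \is 1.-homog by rewrite !(rpredD, rpredZ).
apply: waring_decomposable_consZ => //.
do 2?[apply: waring_decomposable_cons]; try apply: waring_decomposable1;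
  by rewrite !(rpredD, rpredZ, hX, hY, hW).
Qed.

(** The cases are the position of the line aX + bY = 0 through the vertex X = Y = 0 of the triangle:
    it is a side when exactly one of [a], [b] vanishes. Arbitrary forms allow the variables to be
    permuted. *)
Lemma waring4_two_lines_cube a b lambda X Y Z :
  X \is 1.-homog -> Y \is 1.-homog -> Z \is 1.-homog ->
  waring_decomposable 3 (X * Y * Z + lambda *: (a *: X + b *: Y) ^+ 3) 4.
Proof.
move=> hX hY hZ.
have [->|lambda_neq0] := eqVneq lambda 0.
  by rewrite scale0r addr0; apply: waring4_triangle.
have [->|a_neq0] := eqVneq a 0; have [->|b_neq0] := eqVneq b 0.
- by rewrite !scale0r addr0 expr0n scaler0 addr0; apply: waring4_triangle.
- rewrite scale0r add0r exprZn scalerA (mulrC X).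
  by apply: waring4_side_cube; rewrite // mulf_neq0 ?expf_neq0.
- rewrite scale0r addr0 exprZn scalerA.
  by apply: waring4_side_cube; rewrite // mulf_neq0 ?expf_neq0.
- exact: waring4_vertex_cube.
Qed.

(** * Ranks within the family *)

Lemma variable_homog (i : 'I_3) : ('X_i : {mpoly C[3]}) \is 1.-homog.
Proof. by rewrite dhomogX /= mdeg1. Qed.

Lemma waring4_f_lambda a b c lambda :
  waring_decomposable 3 (f_lambda a b c lambda) 4.
Proof.
have hX := variable_homog; rewrite /f_lambda /linear_form.
have [->|c_neq0] := eqVneq c 0.
  by rewrite scale0r addr0; apply: waring4_two_lines_cube.
have [->|b_neq0] := eqVneq b 0.
  by rewrite scale0r addr0 mulrAC; apply: waring4_two_lines_cube.
have [->|a_neq0] := eqVneq a 0.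
  by rewrite scale0r add0r -mulrA mulrC; apply: waring4_two_lines_cube.
by apply: waring4_triangle_cube => //; rewrite !mulf_neq0.
Qed.

Lemma waring3_f_lambda a b c lambda :
  a * b * c != 0 -> 1 + 24 * lambda * (a * b * c) = 0 ->
  waring_decomposable 3 (f_lambda a b c lambda) 3.
Proof. by apply: waring3_triangle_cube; apply: variable_homog. Qed.

Lemma waring_rank4_f_lambda a b c lambda :
  1 + 24 * lambda * (a * b * c) != 0 ->
  is_waring_rank 3 (f_lambda a b c lambda) 4.
Proof.
move=> /eqP lambda_neq; apply: is_waring_rankS => //.
  exact: waring4_f_lambda.
by move=> /f_lambda_three_cubes.
Qed.

Lemma waring_rank3_f_lambda a b c lambda :
  a * b * c != 0 -> 1 + 24 * lambda * (a * b * c) = 0 ->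
  is_waring_rank 3 (f_lambda a b c lambda) 3.
Proof.
move=> abc_neq0 lambda_eq; apply: is_waring_rankS => //.
  exact: waring3_f_lambda.
move=> /f_lambda_two_cubes lambda_eq'.
(* The two conditions have no common solution: this combination eliminates [lambda]. *)
have : 1 = 4 * (1 + 18 * lambda * (a * b * c)) - 3 * (1 + 24 * lambda * (a * b * c)).
  by ring.
by rewrite lambda_eq lambda_eq' !mulr0 subr0 => /eqP; rewrite oner_eq0.
Qed.

End WaringRankFacts.

(** * The exceptional parameter and its uniqueness *)

Theorem proposition3p5 (R : realType) (a b c : R[i]) :
  (a * b * c <> 0 ->
   exists! lambda0 : R[i],
     lambda0 <> 0 /\
     forall lambda : R[i], lambda <> 0 ->
       (lambda = lambda0 -> is_waring_rank 3 (f_lambda a b c lambda) 3) /\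
       (lambda <> lambda0 -> is_waring_rank 3 (f_lambda a b c lambda) 4)) /\
  (a * b * c = 0 ->
   forall lambda : R[i], lambda <> 0 ->
     is_waring_rank 3 (f_lambda a b c lambda) 4).
Proof.
split=> [/eqP abc_neq0|abc_eq0 lambda _]; last first.
  by apply: waring_rank4_f_lambda; rewrite abc_eq0 mulr0 addr0 oner_eq0.
pose lambda0 := - (24 * (a * b * c))^-1.
have d_neq0 : 24 * (a * b * c) != 0 by rewrite mulf_neq0 ?natC_neq0.
have lambda0P lambda : (1 + 24 * lambda * (a * b * c) == 0) = (lambda == lambda0).
  rewrite /lambda0 mulrAC addrC addr_eq0 -(inj_eq (mulfI d_neq0) lambda).
  by rewrite mulrN mulfV.
have lambda0_neq0 : lambda0 <> 0 by apply/eqP; rewrite oppr_eq0 invr_eq0.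
have rank3 : is_waring_rank 3 (f_lambda a b c lambda0) 3.
  by apply: waring_rank3_f_lambda => //; apply/eqP; rewrite lambda0P.
exists lambda0; split=> [|mu [mu_neq0 rank_mu]].
  split=> // lambda lambda_neq0; split=> [-> //|/eqP ne].
  by apply: waring_rank4_f_lambda; rewrite lambda0P.
(* If [mu] differed from [lambda0], its property would force rank 4 at [lambda0], where three cubes
   suffice. *)
apply/eqP; apply: contraT => /eqP ne.
have [_ /(_ ne)[_ min4]] := rank_mu _ lambda0_neq0.
by have := min4 _ rank3.1.
Qed.
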